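(* Consider the lattice $A_4(-2)^{\oplus 4}$ and its automorphism $g:=(\gamma,\gamma,\gamma,\gamma)$ (acting as $\gamma$ on each copy of $A_4(-2)$). For $i,j\in\{1,2,3,4\}$ let $a_{j,i}$ be the element $\alpha_i$ in the $j$-th copy of $A_4(-2)$. In $A_4(-2)^{\oplus 4}\otimes\mathbb{Q}$ let $$\mu:=\tfrac12(a_{1,1}+a_{2,1}+a_{3,1}+a_{4,1}),\qquad \nu:=\tfrac12(a_{2,1}+a_{3,3}+a_{3,4}+a_{4,1}+a_{4,3}+a_{4,4}).$$ Then: (1) The lattice $$L:=A_4(-2)^{\oplus 4}+\langle g^i(\mu),\,g^i(\nu)\rangle_{i=0,1,2,3},$$ generated by $A_4(-2)^{\oplus 4}$ and the $8$ vectors $g^i(\mu),g^i(\nu)$, $i=0,1,2,3$, is an even overlattice of $A_4(-2)^{\oplus 4}$ of rank $16$. (2) The index of $A_4(-2)^{\oplus 4}$ in $L$ is $2^8$. (3) There are no vectors of length $-2$ in $L$.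
   Context: $A_4$ is the positive definite root lattice with basis $\alpha_i=\varepsilon_i-\varepsilon_{i+1}$, $i=1,2,3,4$, where $\{\varepsilon_1,\dots,\varepsilon_5\}$ is the standard orthonormal basis of $\mathbb{R}^5$; put $\alpha_5=\varepsilon_5-\varepsilon_1=-\alpha_1-\alpha_2-\alpha_3-\alpha_4$. The cyclic permutation of the $\varepsilon_i$ induces the isometry $\gamma$ of $A_4$ of order 5 with $\gamma(\alpha_i)=\alpha_{i+1}$ (indices mod 5). $A_4(-2)$ is $A_4$ with its bilinear form multiplied by $-2$ (so $\alpha_i^2=-4$), and $\gamma$ also acts on it; $g$ is extended $\mathbb{Q}$-linearly to $A_4(-2)^{\oplus 4}\otimes\mathbb{Q}$. An overlattice of a lattice $N$ is a lattice (with integral bilinear form) in $N\otimes\mathbb{Q}$ containing $N$ with finite index; it is even if $v\cdot v\in2\mathbb{Z}$ for all its elements $v$. The length of a vector $v$ is its self-intersection $v\cdot v$. *)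

(* Defs.v *)
From HB Require Import structures.
From mathcomp Require Import all_boot all_order all_algebra.
From mathcomp Require Import ring.

Set Implicit Arguments.
Unset Strict Implicit.
Unset Printing Implicit Defensive.

Import Order.TTheory GRing.Theory Num.Theory.
Local Open Scope ring_scope.

(* Lattices are subgroups of an ambient rational vector space V, given as
   predicates on V, together with a rational-valued form on V. *)

Definition symmetric_bilinear (V : vectType rat) (b : V -> V -> rat) : Prop :=
  (forall (c : rat) (x y z : V), b (c *: x + y) z = c * b x z + b y z) /\
  (forall x y : V, b x y = b y x).

(* A family of vectors of a rational vector space is linearly independent over
   the integers iff it is over the rationals, so [free] is the right notion. *)
Definition int_basis (V : vectType rat) (L : V -> Prop) n (B : n.-tuple V) :
  Prop :=
  free B /\ (forall v, L v <-> inIntSpan B v).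

Definition has_rank (V : vectType rat) (L : V -> Prop) (n : nat) : Prop :=
  exists B : n.-tuple V, int_basis L B.

Definition is_lattice (V : vectType rat) (b : V -> V -> rat) (L : V -> Prop) :
  Prop :=
  [/\ symmetric_bilinear b,
      exists n, has_rank L n
    & forall x y, L x -> L y -> b x y \is a Num.int].

Definition is_even (V : vectType rat) (b : V -> V -> rat) (L : V -> Prop) :
  Prop :=
  forall v, L v -> exists k : int, b v v = (2 * k)%:~R.

(* N tensored with Q, as a subspace of V. *)
Definition rational_span (V : vectType rat) (N : V -> Prop) (v : V) : Prop :=
  exists2 X : seq V, (forall x, x \in X -> N x) & v \in <<X>>%VS.

(* For a subgroup N of L: t lists each coset of N in L exactly once. *)
Definition has_index (V : zmodType) (N L : V -> Prop) (n : nat) : Prop :=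
  exists2 t : 'I_n -> V,
    (forall i, L (t i)) & (forall x, L x -> exists! i, N (x - t i)).

Definition is_overlattice (V : vectType rat) (b : V -> V -> rat)
    (N L : V -> Prop) : Prop :=
  [/\ is_lattice b N, is_lattice b L,
      forall v, N v -> L v,
      forall v, L v -> rational_span N v
    & exists n, has_index N L n].

Definition add_generated (V : zmodType) (N : V -> Prop) n (S : n.-tuple V)
    (v : V) : Prop :=
  exists x y, [/\ N x, inIntSpan S y & v = x + y].

Definition scale_form (V : Type) (c : rat) (b : V -> V -> rat) (x y : V) : rat :=
  c * b x y.

Definition dsum_form n (V : Type) (b : V -> V -> rat) (x y : {ffun 'I_n -> V}) :
  rat :=
  \sum_(j < n) b (x j) (y j).

Definition dsum n (V : Type) (L : V -> Prop) (x : {ffun 'I_n -> V}) : Prop :=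
  forall j, L (x j).

(* Indices of eps and alpha are read modulo 5, so that they can be numbered from
   1 to 5 with eps 6 = eps 1. *)
Definition eps (i : nat) : 'rV[rat]_5 := delta_mx 0 (inZp i).

Definition dot5 (x y : 'rV[rat]_5) : rat := \sum_(k < 5) x 0 k * y 0 k.

Definition alpha (i : nat) : 'rV[rat]_5 := eps i - eps i.+1.

Definition A4 : 'rV[rat]_5 -> Prop :=
  inIntSpan [tuple alpha 1; alpha 2; alpha 3; alpha 4].

(* The linear extension of eps k |-> eps k.+1. *)
Definition gamma (x : 'rV[rat]_5) : 'rV[rat]_5 :=
  \sum_(k < 5) x 0 k *: eps k.+1.

Lemma gamma_alpha i : gamma (alpha i) = alpha i.+1.
Proof.
have gE j : gamma (eps j) = eps j.+1.
  rewrite /gamma (bigD1 (inZp j)) //= mxE !eqxx scale1r big1 ?addr0.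
    by congr (delta_mx 0 _); apply/val_inj; rewrite /= -addn1 modnDml addn1.
  by move=> k /negPf kj; rewrite mxE kj andbF scale0r.
rewrite /alpha -!gE /gamma -sumrB; apply: eq_bigr => k _.
by rewrite !mxE scalerBl.
Qed.

Lemma alpha5 : alpha 5 = - alpha 1 - alpha 2 - alpha 3 - alpha 4.
Proof.
have e6 : eps 6 = eps 1 by congr (delta_mx 0 _); apply/val_inj.
by apply/rowP=> k; rewrite /alpha e6 !mxE; ring.
Qed.

(* The rational ambient space of the direct sum of four copies of A4(-2). *)
Definition V4 : vectType rat := {ffun 'I_4 -> 'rV[rat]_5}.

Definition form4 : V4 -> V4 -> rat := dsum_form (scale_form (- 2) dot5).

Definition N4 : V4 -> Prop := dsum A4.

Definition g (x : V4) : V4 := [ffun j => gamma (x j)].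

(* Copies are numbered from 1 to 4, whereas 'I_4 is {0, 1, 2, 3}. *)
Definition a (j i : nat) : V4 :=
  [ffun k : 'I_4 => if k.+1 == j then alpha i else 0].

Definition mu : V4 := 2^-1 *: (a 1 1 + a 2 1 + a 3 1 + a 4 1).

Definition nu : V4 :=
  2^-1 *: (a 2 1 + a 3 3 + a 3 4 + a 4 1 + a 4 3 + a 4 4).

Definition L4 : V4 -> Prop :=
  add_generated N4
    [tuple mu; g mu; g (g mu); g (g (g mu));
           nu; g nu; g (g nu); g (g (g nu))].

(* Main.v *)
(* In coordinates with respect to the alpha's, L is the set of the D / 2, where
   D is a 4 x 4 integer matrix whose rows reduce modulo 2 to x, x + y, x + phi y
   and x + y + phi y, with phi = gamma ^ 2 + gamma ^ 3.  If Q denotes half the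
   norm of A4, the length of D / 2 is - (Q D_1 + .. + Q D_4).

   Evenness: modulo 2 this sum is the polar form of Q at (y, phi y), which is
   even since gamma ^ 2 and gamma ^ 3 are adjoint.  Integrality follows by
   polarization.

   Roots: A4 / 2 A4 is the field with 16 elements, on which phi acts as an
   element of order 3, so x and y parametrize a code of minimum weight 3.  If x
   or y is nonzero modulo 2, then at least three rows are nonzero and the sum of
   the Q D_j is at least 3; otherwise it is divisible by 4. *)

From HB Require Import structures.
Require Import Defs.
From mathcomp Require Import all_boot all_order all_algebra.
From mathcomp Require Import ring lra zify.
Set Implicit Arguments.
Unset Strict Implicit.
Unset Printing Implicit Defensive.
Import Order.TTheory GRing.Theory Num.Theory.
Local Open Scope ring_scope.

(** * Sums and quantifiers over four or five indices *)

Lemma sum_ord4 (M : nmodType) (F : 'I_4 -> M) :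
  \sum_i F i = F (inZp 0) + F (inZp 1) + F (inZp 2) + F (inZp 3).
Proof.
by rewrite !big_ord_recr big_ord0 /= add0r;
  congr (F _ + F _ + F _ + F _); apply/val_inj.
Qed.

Lemma sum_ord5 (M : nmodType) (F : 'I_5 -> M) :
  \sum_i F i = F (inZp 0) + F (inZp 1) + F (inZp 2) + F (inZp 3) + F (inZp 4).
Proof.
by rewrite !big_ord_recr big_ord0 /= add0r;
  congr (F _ + F _ + F _ + F _ + F _); apply/val_inj.
Qed.

Lemma forall_ord4 (P : 'I_4 -> Prop) :
  P (inZp 0) -> P (inZp 1) -> P (inZp 2) -> P (inZp 3) -> forall i, P i.
Proof.
by move=> P0 P1 P2 P3 i; rewrite -[i]valZpK; case: i => -[|[|[|[|]]]].
Qed.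


(** * Coordinates with respect to the simple roots *)

Definition root_comb (c : 'rV[rat]_4) : 'rV[rat]_5 :=
  \sum_(i < 4) c 0 i *: alpha i.+1.

Lemma root_comb_is_linear : linear root_comb.
Proof.
move=> k x y; rewrite /root_comb scaler_sumr -big_split /=.
by apply: eq_bigr => i _; rewrite !mxE scalerDl scalerA.
Qed.
HB.instance Definition _ := GRing.isLinear.Build _ _ _ _ root_comb root_comb_is_linear.

(** Column 0 belongs to [eps 5], because [inZp 5] is 0; hence the list starts with minus the last
    coordinate. *)
Lemma root_combE c :
  root_comb c = \row_k [:: - c 0 (inZp 3); c 0 (inZp 0);
    c 0 (inZp 1) - c 0 (inZp 0); c 0 (inZp 2) - c 0 (inZp 1);
    c 0 (inZp 3) - c 0 (inZp 2)]`_k.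
Proof.
apply/rowP=> k; rewrite summxE sum_ord4 !mxE -[k]valZpK.
by case: k => -[|[|[|[|[|]]]]] //= _; ring.
Qed.

Lemma root_comb_inj : injective root_comb.
Proof.
move=> c d; rewrite !root_combE => /rowP cd; apply/rowP.
have := cd (inZp 1); have := cd (inZp 2); have := cd (inZp 3).
have := cd (inZp 4); rewrite !mxE /= => e4 e3 e2 e1.
by apply: forall_ord4; lra.
Qed.

(** The bilinear form of the Cartan matrix of type A4, over any ring because it serves over both
    [rat] and [int]. *)
Definition A4_form (R : pzRingType) (c d : 'rV[R]_4) : R :=
  2 * (\sum_i c 0 i * d 0 i)
  - \sum_(i < 3) (c 0 (inZp i) * d 0 (inZp i.+1) + c 0 (inZp i.+1) * d 0 (inZp i)).

Lemma dot5_root_comb c d : dot5 (root_comb c) (root_comb d) = A4_form c d.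
Proof.
rewrite /dot5 /A4_form sum_ord5 sum_ord4 !big_ord_recr big_ord0 !root_combE !mxE /=.
by ring.
Qed.

Lemma A4E v : A4 v <-> exists c : 'rV[int]_4, v = root_comb (map_mx intr c).
Proof.
have E (a : 'I_4 -> int) :
  \sum_(i < 4) [tuple alpha 1; alpha 2; alpha 3; alpha 4]`_i *~ a i
    = root_comb (\row_i (a i)%:~R).
  by rewrite /root_comb !sum_ord4 !mxE !scaler_int.
split=> [[c ->]|[c ->]]; rewrite ?E.
  by exists (\row_i c i); congr root_comb; apply/rowP=> i; rewrite !mxE.
exists [ffun i => c 0 i]; rewrite E; congr root_comb.
by apply/rowP=> i; rewrite !mxE ffunE.
Qed.

Definition copies (M : 'M[rat]_4) : V4 := [ffun j => root_comb (row j M)].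

Lemma copies_is_linear : linear copies.
Proof. by move=> k x y; apply/ffunP=> j; rewrite !ffunE !linearP. Qed.
HB.instance Definition _ := GRing.isLinear.Build _ _ _ _ copies copies_is_linear.

Lemma copies_inj : injective copies.
Proof.
move=> M M' /ffunP MM'; apply/row_matrixP=> j.
by apply: root_comb_inj; have := MM' j; rewrite !ffunE.
Qed.

Lemma form4_copies M M' :
  form4 (copies M) (copies M') = - 2 * \sum_j A4_form (row j M) (row j M').
Proof.
rewrite /form4 /dsum_form /scale_form mulr_sumr; apply: eq_bigr => j _.
by rewrite !ffunE dot5_root_comb.
Qed.

Lemma N4E v : N4 v <-> exists M : 'M[int]_4, v = copies (map_mx intr M).
Proof.
split=> [vN|[M -> j]]; last first.
  by apply/A4E; exists (row j M); rewrite ffunE map_row.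
(* Boolean equality lets [xchoose] pick integer coordinates in all copies at once. *)
have {}vN j : exists c : 'rV[int]_4, v j == root_comb (map_mx intr c).
  by have /A4E[c ->] := vN j; exists c.
exists (\matrix_j xchoose (vN j)); apply/ffunP=> j.
by rewrite ffunE -map_row rowK; apply/eqP/(xchooseP (vN j)).
Qed.

(** * The action of [gamma] and the orbits of [mu] and [nu] in coordinates *)

Lemma alpha_addn5 i : alpha (i + 5) = alpha i.
Proof.
have E k : eps (k + 5) = eps k.
  by congr (delta_mx 0 _); apply/val_inj; rewrite /= modnDr.
by rewrite /alpha -addSn !E.
Qed.

Lemma gamma_is_linear : linear gamma.
Proof.
move=> k x y; rewrite /gamma scaler_sumr -big_split /=.
by apply: eq_bigr => i _; rewrite !mxE scalerDl scalerA.
Qed.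
HB.instance Definition _ := GRing.isLinear.Build _ _ _ _ gamma gamma_is_linear.

(* The action of gamma ^ 2 + gamma ^ 3 on coordinates in alpha 1, .., alpha 4. *)
Definition phi (R : pzRingType) (y : 'rV[R]_4) : 'rV[R]_4 :=
  let y0 := y 0 (inZp 0) in let y1 := y 0 (inZp 1) in
  let y2 := y 0 (inZp 2) in let y3 := y 0 (inZp 3) in
  \row_k [:: y3 - y1; y3 - y1 - y2; y0 - y1 - y2; y0 - y2]`_k.

(** Twice the coordinates, one row per copy, of the combination of the g^i mu with coefficients [x]
    and the g^i nu with coefficients [y]. *)
Definition glue (R : pzRingType) (x y : 'rV[R]_4) : 'M[R]_4 :=
  \matrix_j [:: x; x + y; x + phi y; x + y + phi y]`_j.


Lemma mu_ffunE : mu = [ffun j => 2^-1 *: alpha 1].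
Proof.
by apply/ffunP; apply: forall_ord4; rewrite /mu !ffunE /= ?addr0 ?add0r.
Qed.

Lemma nu_ffunE : nu = [ffun j : 'I_4 => 2^-1 *:
   [:: 0; alpha 1; alpha 3 + alpha 4; alpha 1 + alpha 3 + alpha 4]`_j].
Proof.
by apply/ffunP; apply: forall_ord4; rewrite /nu !ffunE /= ?addr0 ?add0r.
Qed.

Lemma iter_g i x j : iter i g x j = iter i gamma (x j).
Proof. by elim: i => //= i <-; rewrite ffunE. Qed.

(** A polynomial of degree at most 3 in [gamma] applied to [v]; orbit sums under [g] reduce to it
    copy by copy. *)
Definition orbit_comb (c : 'rV[rat]_4) (v : 'rV[rat]_5) : 'rV[rat]_5 :=
  \sum_(i < 4) c 0 i *: iter i gamma v.

Lemma orbit_comb_is_linear c : linear (orbit_comb c).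
Proof.
move=> k x y; rewrite /orbit_comb scaler_sumr -big_split /=.
apply: eq_bigr => i _.
suff -> : iter i gamma (k *: x + y) = k *: iter i gamma x + iter i gamma y.
  by rewrite scalerDr !scalerA mulrC.
by elim: (i : nat) => //= n ->; rewrite linearP.
Qed.
HB.instance Definition _ c :=
  GRing.isLinear.Build _ _ _ _ (orbit_comb c) (orbit_comb_is_linear c).

Lemma iter_gamma_alpha i n : iter n gamma (alpha i) = alpha (i + n).
Proof. by elim: n => [|n /= ->]; rewrite ?addn0 // gamma_alpha addnS. Qed.

Lemma orbit_comb_alpha1 c : orbit_comb c (alpha 1) = root_comb c.
Proof. by apply: eq_bigr => i _; rewrite iter_gamma_alpha. Qed.

(** [alpha 3 + alpha 4] is the image of [alpha 1] under gamma ^ 2 + gamma ^ 3, which commutes with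
    [gamma]. The indices reach 7 and are folded back modulo 5. *)
Lemma orbit_comb_phi c : orbit_comb c (alpha 3 + alpha 4) = root_comb (phi c).
Proof.
have a6 := alpha_addn5 1; have a7 := alpha_addn5 2; rewrite /= in a6 a7.
rewrite linearD /= /orbit_comb /root_comb !sum_ord4 !iter_gamma_alpha /= !mxE /=.
rewrite !addnE /= in a6 a7 *; rewrite a6 a7 alpha5.
by apply/rowP=> k; rewrite !mxE; ring.
Qed.

Lemma orbit_sum_mu (c : 'rV[rat]_4) :
  \sum_(i < 4) c 0 i *: iter i g mu = copies (2^-1 *: glue c 0).
Proof.
apply/ffunP=> j; rewrite sum_ffunE ffunE linearZ linearZ /=.
under eq_bigr do rewrite ffunE iter_g mu_ffunE ffunE.
rewrite -/(orbit_comb c _) linearZ /= orbit_comb_alpha1; congr (_ *: root_comb _).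
have phi0 : phi 0 = 0 :> 'rV[rat]_4.
  apply/rowP; apply: forall_ord4; rewrite !mxE /= ?subr0 //.
by move: j; apply: forall_ord4; rewrite rowK /= ?phi0 ?addr0.
Qed.

Lemma orbit_sum_nu (c : 'rV[rat]_4) :
  \sum_(i < 4) c 0 i *: iter i g nu = copies (2^-1 *: glue 0 c).
Proof.
apply/ffunP=> j; rewrite sum_ffunE ffunE linearZ linearZ /=.
under eq_bigr do rewrite ffunE iter_g nu_ffunE ffunE.
rewrite -/(orbit_comb c _) linearZ /=; congr (_ *: _).
move: j; apply: forall_ord4; rewrite rowK /= ?add0r ?linear0 ?orbit_comb_alpha1
  ?orbit_comb_phi //.
by rewrite -addrA linearD /= orbit_comb_phi orbit_comb_alpha1 linearD.
Qed.

(** * Integral coordinates on [N4] and [L4], and their ranks *)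

Lemma has_rank_image (V : vectType rat) (L : V -> Prop) m n
    (F : {linear 'M[rat]_(m, n) -> V}) :
  injective F -> (forall v, L v <-> exists C, v = F (map_mx intr C)) ->
  has_rank L (m * n).
Proof.
(* The basis is the image of the elementary matrices; injectivity of [F] over the rationals makes it
   free. *)
move=> Finj LE; exists [tuple F (vec_mx (delta_mx 0 k)) | k < m * n].
have sumE (c : 'I_(m * n) -> rat) :
    \sum_(k < m * n) c k *: [tuple F (vec_mx (delta_mx 0 k)) | k < m * n]`_k =
    F (vec_mx (\row_k c k)).
  rewrite [\row_k c k]row_sum_delta !linear_sum; apply: eq_bigr => k _.
  by rewrite -tnth_nth tnth_mktuple mxE !linearZ.
split=> [|v].
  apply/freeP => c; rewrite sumE -(linear0 F) => /Finj /(canRL vec_mxK) c0 k.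
  by move/rowP/(_ k): c0; rewrite linear0 !mxE.
rewrite LE; split=> [[C ->]|[c ->]].
  exists [ffun k => mxvec C 0 k].
  under eq_bigr do rewrite -scaler_int.
  rewrite sumE; congr (F _); apply: (canRL mxvecK); rewrite -map_mxvec.
  by apply/rowP=> k; rewrite !mxE ffunE.
exists (vec_mx (\row_k c k)).
under eq_bigr do rewrite -scaler_int.
rewrite sumE map_vec_mx; congr (F (vec_mx _)).
by apply/rowP=> k; rewrite !mxE.
Qed.

(** Vectors of [L4] have half-integral coordinates, so doubling them allows integer matrices
    throughout. *)
Definition half (D : 'M[int]_4) : V4 := copies (2^-1 *: map_mx intr D).

Lemma half_is_zmod_morphism : zmod_morphism half.
Proof. by move=> D D'; rewrite /half map_mxB scalerBr linearB. Qed.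
HB.instance Definition _ := GRing.isZmodMorphism.Build _ _ half half_is_zmod_morphism.

Lemma half_double D : half (D *+ 2) = copies (map_mx intr D).
Proof.
rewrite /half [D *+ 2]mulr2n; congr copies; apply/matrixP=> i j.
by rewrite !mxE intrD; field.
Qed.

Lemma N4_half D : N4 (half D) <-> exists M, D = M *+ 2.
Proof.
rewrite N4E; split=> [[M]|[M ->]]; last by exists M; rewrite half_double.
rewrite -half_double => /copies_inj/matrixP DM; exists M; apply/matrixP=> i j.
have := DM i j; rewrite !mxE => /(mulfI _) DMij.
by apply: (@intr_inj rat); apply: DMij.
Qed.

Lemma N4_double v : N4 v <-> exists D, v = half (D *+ 2).
Proof. by rewrite N4E; split=> -[M ->]; exists M; rewrite half_double. Qed.

Lemma phiD (R : comNzRingType) : {morph @phi R : x y / x + y}.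
Proof.
move=> x y; apply/rowP=> k; rewrite -[k]valZpK !mxE.
by case: k => -[|[|[|[|]]]] //= _; ring.
Qed.

Lemma glueD (R : comNzRingType) (x y x' y' : 'rV[R]_4) :
  glue (x + x') (y + y') = glue x y + glue x' y'.
Proof.
rewrite /glue phiD; move: (phi y) (phi y') => p p'.
apply/matrixP=> i j; move: i; apply: forall_ord4; rewrite !mxE /= ?mxE; ring.
Qed.

Lemma map_phi (y : 'rV[int]_4) :
  map_mx intr (phi y) = phi (map_mx intr y) :> 'rV[rat]_4.
Proof. by apply/rowP; apply: forall_ord4; rewrite !mxE /= !rmorphB. Qed.

Lemma map_glue (x y : 'rV[int]_4) :
  map_mx intr (glue x y) = glue (map_mx intr x) (map_mx intr y) :> 'M[rat]_4.
Proof.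
by apply/row_matrixP; apply: forall_ord4;
  rewrite -map_row !rowK /= ?map_mxD ?map_phi.
Qed.

(* Twice the coordinates, in the alpha's, of the element of L4 with coordinates
   C in the basis g^i mu, g^i nu, a 3 i.+1, a 4 i.+1 (0 <= i <= 3). *)
Definition double_coords (R : pzRingType) (C : 'M[R]_4) : 'M[R]_4 :=
  let x := row (inZp 0) C in let y := row (inZp 1) C in
  \matrix_j [:: x; x + y; x + phi y + row (inZp 2) C *+ 2;
                x + y + phi y + row (inZp 3) C *+ 2]`_j.

Lemma L4_glue v :
  L4 v <-> exists x y M, v = half (glue x y + M *+ 2).
Proof.
have sumE (c : 'I_(4 + 4) -> int) :
    \sum_(i < 8) [tuple mu; g mu; g (g mu); g (g (g mu));
             nu; g nu; g (g nu); g (g (g nu))]`_i *~ c i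
    = half (glue (\row_i c (lshift 4 i)) (\row_i c (rshift 4 i))).
  rewrite (@big_split_ord _ _ _ 4 4) /= /half.
  (* Splits [glue x y] as [glue x 0 + glue 0 y], the parts coming from [mu] and from [nu]. *)
  rewrite -[X in glue X _]addr0 -[X in glue _ X]add0r glueD map_mxD scalerDr.
  rewrite linearD /= !map_glue (@map_mx0 _ _ intr) -orbit_sum_mu -orbit_sum_nu.
  by congr (_ + _); rewrite !sum_ord4 !mxE -!scaler_int.
split=> [[_ [_ [/N4_double[M ->] [c ->] ->]]]|[x [y [M ->]]]].
  rewrite sumE; do 3 eexists; rewrite addrC -raddfD; reflexivity.
exists (half (M *+ 2)), (half (glue x y)); split; last by rewrite addrC raddfD.
  by apply/N4_double; exists M.
exists [ffun i : 'I_(4 + 4) => match split i with inl k => x 0 k | inr k => y 0 k end].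
rewrite sumE; congr (half (glue _ _)); apply/rowP=> k; rewrite !mxE ffunE.
  by rewrite (unsplitK (inl k)).
by rewrite (unsplitK (inr k)).
Qed.

Lemma map_double_coords (C : 'M[int]_4) :
  map_mx intr (double_coords C) = double_coords (map_mx intr C) :> 'M[rat]_4.
Proof.
by apply/row_matrixP; apply: forall_ord4;
  rewrite -map_row !rowK /= ?map_mxD ?raddfMn /= ?map_phi !map_row.
Qed.

(** Removes the redundancy of the triples in [L4_glue], leaving 16 free integer parameters as the
    rank requires. *)
Lemma L4_half v : L4 v <-> exists C, v = half (double_coords C).
Proof.
rewrite L4_glue; split=> [[x [y [M ->]]]|[C ->]]; last first.
  exists (row (inZp 0) C), (row (inZp 1) C).
  exists (\matrix_j [:: 0; 0; row (inZp 2) C; row (inZp 3) C]`_j).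
  congr half; apply/row_matrixP; apply: forall_ord4;
    rewrite linearD raddfMn /= !rowK /= ?mul0rn ?addr0 //.
pose m k := row (inZp k) M.
(* Rows 0 and 1 of [M] are absorbed into [x] and [y]; the last two entries compensate for the effect
   on rows 2 and 3. *)
exists (\matrix_j [:: x + m 0 *+ 2; y + (m 1 - m 0) *+ 2;
   m 2 - m 0 - phi (m 1 - m 0); m 3 - m 1 - phi (m 1 - m 0)]`_j).
congr half; apply/row_matrixP; apply: forall_ord4;
  rewrite linearD raddfMn /= !rowK /= ?phiD ?[_ *+ 2]mulr2n ?phiD.
all: rewrite -/(m 0) -/(m 1) -/(m 2) -/(m 3).
all: move: (m 0) (m 1) (m 2) (m 3) (phi y) (phi (m 1 - m 0)) => m0 m1 m2 m3 py p.
all: by apply/rowP=> k; rewrite !mxE; ring.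
Qed.

Lemma double_coords_is_linear : linear (@double_coords rat).
Proof.
have phiZ k (x : 'rV[rat]_4) : phi (k *: x) = k *: phi x.
  by apply/rowP; apply: forall_ord4; rewrite !mxE /=; ring.
move=> k C C'; rewrite /double_coords !linearP phiD phiZ.
move: (phi _) (phi _) => p p'.
apply/matrixP=> i j; move: i; apply: forall_ord4; rewrite !mxE /= ?mxE; ring.
Qed.
HB.instance Definition _ := GRing.isLinear.Build _ _ _ _
  (@double_coords rat) double_coords_is_linear.

Lemma double_coords_inj : injective (@double_coords rat).
Proof.
apply: raddf_inj => C /matrixP C0.
have r0 : row (inZp 0) C = 0.
  by apply/rowP=> k; have := C0 (inZp 0) k; rewrite !mxE /= ?mxE.
have r1 : row (inZp 1) C = 0.
  apply/rowP=> k; have := C0 (inZp 1) k.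
  by rewrite [double_coords _ _ _]mxE /= r0 add0r !mxE.
have phi0 : phi 0 = 0 :> 'rV[rat]_4.
  by apply/rowP; apply: forall_ord4; rewrite !mxE /= ?subr0.
apply/row_matrixP; apply: forall_ord4; rewrite ?r0 ?r1 linear0 //.
all: apply/rowP=> k.
  have := C0 (inZp 2) k; rewrite [double_coords _ _ _]mxE /= r0 r1 phi0 !add0r.
  by rewrite [_ *+ 2]mulr2n !mxE; lra.
have := C0 (inZp 3) k; rewrite [double_coords _ _ _]mxE /= r0 r1 phi0 !add0r.
by rewrite [_ *+ 2]mulr2n !mxE; lra.
Qed.

Lemma has_rank_N4 : has_rank N4 16.
Proof. exact: (has_rank_image copies_inj N4E). Qed.

Lemma has_rank_L4 : has_rank L4 16.
Proof.
pose F := copies \o ( *:%R 2^-1 \o @double_coords rat).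
have Finj : injective F.
  by apply: inj_comp copies_inj _; apply: inj_comp double_coords_inj; apply: scalerI.
apply: (has_rank_image (F := F)) => // v.
by rewrite L4_half; split=> -[C ->]; exists C; rewrite /F /half /= map_double_coords.
Qed.

(** * Residues modulo 2 and the index *)

Definition bits (x : 'rV[int]_4) : 'rV[bool]_4 := \row_k odd `|x 0 k|.

Definition of_bits (b : 'rV[bool]_4) : 'rV[int]_4 := \row_k (b 0 k)%:Z.

Lemma bitsP x b : bits x = b <-> exists u, x = of_bits b + u *+ 2.
Proof.
split=> [<-|[u ->]].
  exists (\row_k divz (x 0 k) 2); apply/rowP=> k; rewrite [_ *+ 2]mulr2n !mxE; lia.
apply/rowP=> k; rewrite [_ *+ 2]mulr2n !mxE; case: (b 0 k); lia.
Qed.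

(** A coset is given by the residues of [x] and [y] modulo 2, which leaves 2^4 choices for each. *)
Lemma has_index_N4_L4 : has_index N4 L4 (2 ^ 8).
Proof.
pose T : finType := ('rV[bool]_4 * 'rV[bool]_4)%type.
have <- : #|T| = (2 ^ 8)%N by rewrite card_prod !card_mx card_bool.
pose rep (b : T) := glue (of_bits b.1) (of_bits b.2).
exists (fun k : 'I_#|T| => half (rep (enum_val k))) => [k|v].
  apply/L4_glue; exists (of_bits (enum_val k).1), (of_bits (enum_val k).2), 0.
  by rewrite mul0rn addr0.
case/L4_glue=> x [y [M ->]]; exists (enum_rank (bits x, bits y)).
rewrite /unique enum_rankK -raddfB; split=> [|k].
  apply/N4_half; rewrite /rep /=.
  have [[u {1}->] [w {1}->]] := (proj1 (bitsP x _) erefl, proj1 (bitsP y _) erefl).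
  exists (glue u w + M).
  by rewrite [u *+ 2]mulr2n [w *+ 2]mulr2n !glueD -mulr2n mulrnDl
    -!addrA addrC !addrA subrK.
rewrite -raddfB => /N4_half[M' /matrixP MM'].
apply: enum_val_inj; rewrite enum_rankK; case: (enum_val k) MM' => b c /= MM'.
(* Rows 0 and 1 are congruent to [x] and [x + y] modulo 2, so they already determine both
   residues. *)
have e0 k' := MM' (inZp 0) k'; have e1 k' := MM' (inZp 1) k'.
have eb : bits x = b.
  apply/bitsP; exists (row (inZp 0) (M' - M)).
  by apply/rowP=> k'; have := e0 k'; rewrite ![_ *+ 2]mulr2n !mxE /= ?mxE; lia.
congr pair => //; apply/bitsP.
exists (row (inZp 1) (M' - M) - row (inZp 0) (M' - M)).
by apply/rowP=> k'; have := e0 k'; have := e1 k';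
  rewrite ![_ *+ 2]mulr2n !mxE /= ?mxE; lia.
Qed.

(** * The norm in integral coordinates and its parity *)

(** Half the norm of A4, the form Q of the opening outline. *)
Definition A4_norm (d : 'rV[int]_4) : int :=
  \sum_i d 0 i ^+ 2 - \sum_(i < 3) d 0 (inZp i) * d 0 (inZp i.+1).

Lemma A4_normE (d : 'rV[int]_4) : let d0 := d 0 (inZp 0) in let d1 := d 0 (inZp 1) in
  let d2 := d 0 (inZp 2) in let d3 := d 0 (inZp 3) in
  A4_norm d = d0 ^+ 2 + d1 ^+ 2 + d2 ^+ 2 + d3 ^+ 2 - d0 * d1 - d1 * d2 - d2 * d3.
Proof. by rewrite /A4_norm sum_ord4 !big_ord_recr big_ord0 /=; ring. Qed.

(** The squares are those of the five coordinates in the [eps]; positive definiteness is read off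
    from them. *)
Lemma A4_norm_sum_sqr (d : 'rV[int]_4) :
  let d0 := d 0 (inZp 0) in let d1 := d 0 (inZp 1) in
  let d2 := d 0 (inZp 2) in let d3 := d 0 (inZp 3) in
  2 * A4_norm d = d0 ^+ 2 + (d0 - d1) ^+ 2 + (d1 - d2) ^+ 2 + (d2 - d3) ^+ 2 + d3 ^+ 2.
Proof. by rewrite A4_normE /=; ring. Qed.

Lemma A4_norm_ge0 d : 0 <= A4_norm d.
Proof.
by rewrite -(pmulr_rge0 _ (ltr0Sn int 1)) A4_norm_sum_sqr !addr_ge0 // sqr_ge0.
Qed.

Lemma A4_norm_eq0 d : A4_norm d = 0 -> d = 0.
Proof.
move=> d0; have := A4_norm_sum_sqr d; rewrite d0 mulr0 => /esym/eqP.
rewrite !paddr_eq0 ?addr_ge0 ?sqr_ge0 // !sqrf_eq0.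
move=> /andP[/andP[/andP[/andP[/eqP e0 /eqP e1] /eqP e2] /eqP e3] /eqP e4].
apply/rowP; apply: forall_ord4; rewrite mxE; lia.
Qed.

(** The factors are -2 from the scaling, 1/4 from the two halves and 2 because [A4_norm] is half the
    norm. *)
Lemma form4_half D : form4 (half D) (half D) = - (\sum_j A4_norm (row j D))%:~R.
Proof.
rewrite /half form4_copies mulr_sumr rmorph_sum -sumrN; apply: eq_bigr => j _.
rewrite A4_normE /A4_form sum_ord4 !big_ord_recr !big_ord0 /= !mxE /=.
rewrite !(intrD, rmorphB, rmorphXn, rmorphM) /=; by field.
Qed.

Lemma A4_norm_double d : A4_norm (d *+ 2) = 4 * A4_norm d.
Proof. by rewrite [d *+ 2]mulr2n !A4_normE !mxE; ring. Qed.

Lemma A4_normD c d : A4_norm (c + d) = A4_norm c + A4_norm d + A4_form c d.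
Proof.
by rewrite !A4_normE /A4_form sum_ord4 !big_ord_recr !big_ord0 /= !mxE; ring.
Qed.

(* gamma ^ 2 and gamma ^ 3 are adjoint, so y pairs equally with gamma ^ 2 y,
   whose coordinates are displayed here, and with gamma ^ 3 y. *)
Lemma A4_form_phi (y : 'rV[int]_4) :
  let y0 := y 0 (inZp 0) in let y1 := y 0 (inZp 1) in
  let y2 := y 0 (inZp 2) in let y3 := y 0 (inZp 3) in
  A4_form y (phi y) = 2 * A4_form y (\row_k [:: y3 - y2; - y2; y0 - y2; y1 - y2]`_k).
Proof.
by rewrite /A4_form !sum_ord4 !big_ord_recr !big_ord0 /= !mxE /=; ring.
Qed.

Lemma A4_formDr (c d d' : 'rV[int]_4) :
  A4_form c (d + d') = A4_form c d + A4_form c d'.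
Proof.
by rewrite /A4_form !sum_ord4 !big_ord_recr !big_ord0 /= !mxE; ring.
Qed.

Lemma A4_formDl (c c' d : 'rV[int]_4) :
  A4_form (c + c') d = A4_form c d + A4_form c' d.
Proof.
by rewrite /A4_form !sum_ord4 !big_ord_recr !big_ord0 /= !mxE; ring.
Qed.

(** When the four rows are expanded, every term has an even coefficient except the pairing of [y]
    with [phi y], which is even by [A4_form_phi]. *)
Lemma A4_norm_glue_even (x y : 'rV[int]_4) M :
  exists k, \sum_j A4_norm (row j (glue x y + M *+ 2)) = 2 * k.
Proof.
have rowE j : A4_norm (row j (glue x y + M *+ 2)) = A4_norm (row j (glue x y))
    + 2 * (2 * A4_norm (row j M) + A4_form (row j (glue x y)) (row j M)).
  rewrite linearD raddfMn /= A4_normD A4_norm_double [_ *+ 2]mulr2n A4_formDr; ring.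
under eq_bigr do rewrite rowE.
rewrite big_split /= -mulr_sumr; set k := (\sum_i _ in X in 2 * X).
rewrite sum_ord4 !rowK /= !A4_normD A4_formDl A4_form_phi.
set b := A4_form y (\row_k _).
exists (2 * A4_norm x + A4_norm y + A4_norm (phi y) + A4_form x y
        + A4_form x (phi y) + b + k).
by rewrite /=; ring.
Qed.

(** * Absence of vectors of length -2 *)

(** Modulo 2, two rows differ by [y], [phi y] or [y + phi y]. Since phi ^ 2 + phi + 1 vanishes
    modulo 2, both [phi] and 1 + phi are invertible there, so [y] vanishes, and then [x]. *)
Lemma glue_two_zero_rows (x y : 'rV[int]_4) M (i j : 'I_4) : (i < j)%N ->
  row i (glue x y + M *+ 2) = 0 -> row j (glue x y + M *+ 2) = 0 ->
  bits x = const_mx false /\ bits y = const_mx false.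
Proof.
have rowE k : row k (glue x y + M *+ 2) = row k (glue x y) + (row k M + row k M).
  by rewrite linearD raddfMn /= mulr2n.
rewrite !rowE; move: i j.
apply: forall_ord4; apply: forall_ord4 => //= _; rewrite !rowK /=;
  move: (row _ _) (row _ _) => m m' /rowP ri /rowP rj.
all: have := ri (inZp 0); have := ri (inZp 1); have := ri (inZp 2); have := ri (inZp 3).
all: have := rj (inZp 0); have := rj (inZp 1); have := rj (inZp 2); have := rj (inZp 3).
all: clear ri rj; rewrite !mxE /= => *.
all: by split; apply/rowP; apply: forall_ord4; rewrite !mxE; lia.
Qed.

Lemma sum_A4_norm_neq2 (x y : 'rV[int]_4) M :
  \sum_j A4_norm (row j (glue x y + M *+ 2)) <> 2.
Proof.
set D := glue x y + M *+ 2 => sum2.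
(* Two zero rows would make [D] twice an integer matrix, and the sum a multiple of 4. *)
have not_two_zero (i j : 'I_4) : (i < j)%N ->
    A4_norm (row i D) = 0 -> A4_norm (row j D) = 0 -> False.
  move=> ij /A4_norm_eq0 Di /A4_norm_eq0 Dj.
  have [] := glue_two_zero_rows ij Di Dj.
  have of_bits0 : of_bits (const_mx false) = 0 by apply/rowP=> k; rewrite !mxE.
  move=> /bitsP[u]; rewrite of_bits0 add0r => xu /bitsP[w].
  rewrite of_bits0 add0r => yw.
  have DE : D = (glue u w + M) *+ 2.
    by rewrite /D xu yw [u *+ 2]mulr2n [w *+ 2]mulr2n glueD -mulr2n mulrnDl.
  move: sum2; rewrite DE; under eq_bigr do rewrite raddfMn /= A4_norm_double.
  rewrite -mulr_sumr; lia.
have ge0 j := A4_norm_ge0 (row j D).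
move: sum2; rewrite sum_ord4.
have := ge0 (inZp 0); have := ge0 (inZp 1); have := ge0 (inZp 2); have := ge0 (inZp 3).
have := not_two_zero (inZp 0) (inZp 1) isT; have := not_two_zero (inZp 0) (inZp 2) isT.
have := not_two_zero (inZp 0) (inZp 3) isT; have := not_two_zero (inZp 1) (inZp 2) isT.
have := not_two_zero (inZp 1) (inZp 3) isT; have := not_two_zero (inZp 2) (inZp 3) isT.
(* At most one of these nonnegative integers is 0, so the sum is at least 3. *)
move: (A4_norm _) (A4_norm _) (A4_norm _) (A4_norm _) => n0 n1 n2 n3; lia.
Qed.

(** * Evenness, integrality and the overlattice property *)

Lemma form4_bilinear : symmetric_bilinear form4.
Proof.
split=> [c x y z|x y].
  rewrite /form4 /dsum_form mulr_sumr -big_split; apply: eq_bigr => j _ /=.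
  rewrite /scale_form /dot5 !ffunE !mulr_sumr -big_split; apply: eq_bigr => k _ /=.
  by rewrite !mxE; ring.
apply: eq_bigr => j _; congr (_ * _); apply: eq_bigr => k _; exact: mulrC.
Qed.

Lemma is_even_L4 : is_even form4 L4.
Proof.
move=> _ /L4_glue[x [y [M ->]]]; have [k Ek] := A4_norm_glue_even x y M.
by exists (- k); rewrite form4_half Ek mulrN rmorphN.
Qed.

(** Polarization: 2 b(x, y) is b(x + y, x + y) - b(x, x) - b(y, y), a combination of even
    integers. *)
Lemma even_is_integral (V : vectType rat) (b : V -> V -> rat) (L : V -> Prop) :
  symmetric_bilinear b -> (forall x y, L x -> L y -> L (x + y)) ->
  is_even b L -> forall x y, L x -> L y -> b x y \is a Num.int.
Proof.
move=> [bl bC] LD Leven x y Lx Ly.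
have bD u v w : b (u + v) w = b u w + b v w by rewrite -[u]scale1r bl mul1r scale1r.
have [k Ek] := Leven _ (LD _ _ Lx Ly).
have [l El] := Leven _ Lx; have [m Em] := Leven _ Ly.
suff -> : b x y = (k - l - m)%:~R by apply: intr_int.
move: Ek; rewrite bD ![b _ (x + y)]bC !bD (bC y x) El Em !(rmorphB, rmorphM) /=.
lra.
Qed.

Lemma L4D u v : L4 u -> L4 v -> L4 (u + v).
Proof.
move=> /L4_glue[x [y [M ->]]] /L4_glue[x' [y' [M' ->]]].
apply/L4_glue; exists (x + x'), (y + y'), (M + M').
by rewrite -raddfD glueD mulrnDl addrACA.
Qed.

Lemma N4_sub_L4 v : N4 v -> L4 v.
Proof.
move=> /N4_double[D ->]; apply/L4_glue; exists 0, 0, D.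
suff -> : glue 0 0 = 0 :> 'M[int]_4 by rewrite add0r.
by apply: (addrI (glue 0 0)); rewrite -glueD !addr0.
Qed.

Lemma is_overlattice_L4 : is_overlattice form4 N4 L4.
Proof.
have int_form := even_is_integral form4_bilinear L4D is_even_L4.
split; last by exists (2 ^ 8)%N; apply: has_index_N4_L4.
- split; [exact: form4_bilinear | by exists 16; apply: has_rank_N4 |].
  by move=> x y /N4_sub_L4 Lx /N4_sub_L4; apply: int_form.
- by split; [exact: form4_bilinear | exists 16; apply: has_rank_L4 |].
- exact: N4_sub_L4.
move=> _ /L4_glue[x [y [M ->]]]; set D := glue x y + M *+ 2.
(* Twice the vector lies in [N4], so this one vector spans it over the rationals. *)
exists [:: half (D *+ 2)] => [v|].
  by rewrite inE => /eqP->; apply/N4_double; exists D.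
rewrite span_seq1 raddfMn; apply/vlineP; exists 2^-1.
by rewrite /= -scaler_nat scalerA mulVf // scale1r.
Qed.

Theorem proposition3p1 :
  [/\ (* (1) *)
      is_overlattice form4 N4 L4 /\ is_even form4 L4 /\ has_rank L4 16,
      (* (2) *)
      has_index N4 L4 (2 ^ 8)%N
    & (* (3) *)
      ~ (exists v : V4, L4 v /\ form4 v v = - 2)].
Proof.
split.
- split; first exact: is_overlattice_L4.
  by split; [exact: is_even_L4 | exact: has_rank_L4].
- exact: has_index_N4_L4.
case=> _ [/L4_glue[x [y [M ->]]]]; rewrite form4_half => /oppr_inj sum2.
by apply: (@sum_A4_norm_neq2 x y M); apply: (@intr_inj rat); rewrite sum2.
Qed.
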